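(* Properties A$'$ and B$'$ hold for all Coxeter systems $(W,S)$ of rank two (that is, with $|S|=2$), with respect to every $S$-preserving involution $*$ of $W$.
   Context: Let $(W,S)$ be a Coxeter system (possibly infinite) with length function $\ell$ and Bruhat order $\le$; let $\mathcal A=\mathbb Z[v,v^{-1}]$ and $q=v^2$. Hecke algebra $\mathcal H_q$: the free $\mathcal A$-module with basis $\{t_w\}_{w\in W}$ and the unique $\mathcal A$-algebra structure with $t_st_w=t_{sw}$ if $sw>w$ and $t_st_w=qt_{sw}+(q-1)t_w$ if $sw<w$ ($s\in S$, $w\in W$). Its bar operator is the ring involution with $\overline{v^n}=v^{-n}$ and $\overline{t_w}=(t_{w^{-1}})^{-1}$. The Kazhdan-Lusztig polynomials $P_{y,w}\in\mathbb Z[q]$ ($y,w\in W$) are the unique family such that $c_w=v^{-\ell(w)}\sum_{y\in W}P_{y,w}t_y$ satisfies $\overline{c_w}=c_w$; $P_{y,w}=\delta_{y,w}$ if $y\not<w$; and $\deg_q P_{y,w}\le\frac12(\ell(w)-\ell(y)-1)$ if $y<w$. Hecke algebra $\mathcal H_{q^2}$: the free $\mathcal A$-module with basis $\{T_w\}_{w\in W}$, with $T_sT_w=T_{sw}$ if $sw>w$ and $T_sT_w=q^2T_{sw}+(q^2-1)T_w$ if $sw<w$; its bar operator is the ring involution with $\overline{v^n}=v^{-n}$, $\overline{T_w}=(T_{w^{-1}})^{-1}$. Twisted theory: an $S$-preserving involution is an automorphism $*:w\mapsto w^*$ of $W$ of order $\le 2$ (the identity is allowed) with $S^*=S$. Let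 $\mathbf I_*=\{w\in W: w^*=w^{-1}\}$. For $s\in S$, $w\in\mathbf I_*$ put $s\ltimes w=sw$ if $sw=ws^*$ and $s\ltimes w=sws^*$ otherwise. Let $\mathcal M_{q^2}$ be the free $\mathcal A$-module with basis $\{a_w\}_{w\in\mathbf I_*}$ and the unique $\mathcal H_{q^2}$-module structure such that $T_sa_w=a_{s\ltimes w}$ if $s\ltimes w=sws^*>w$; $T_sa_w=(q+1)a_{s\ltimes w}+qa_w$ if $s\ltimes w=sw>w$; $T_sa_w=(q^2-q)a_{s\ltimes w}+(q^2-q-1)a_w$ if $s\ltimes w=sw<w$; $T_sa_w=q^2a_{s\ltimes w}+(q^2-1)a_w$ if $s\ltimes w=sws^*<w$. Its bar operator is the unique $\mathbb Z$-linear involution with $\overline{a_1}=a_1$ and $\overline{hm}=\overline h\,\overline m$ for $h\in\mathcal H_{q^2}$, $m\in\mathcal M_{q^2}$. The twisted Kazhdan-Lusztig polynomials $P^\sigma_{y,w}\in\mathbb Z[q]$ ($y,w\in\mathbf I_*$) are the unique family such that $A_w=v^{-\ell(w)}\sum_{y\in\mathbf I_*}P^\sigma_{y,w}a_y$ satisfies $\overline{A_w}=A_w$; $P^\sigma_{y,w}=\delta_{y,w}$ if $y\not<w$; and $\deg_qP^\sigma_{y,w}\le\frac12(\ell(w)-\ell(y)-1)$ if $y<w$. Put $P^\pm_{y,w}=\frac12(P_{y,w}\pm P^\sigma_{y,w})$ for $y,w\in\mathbf I_*$. Properties of a triple $(W,S,* )$: (A$'$) $P^+_{y,w}$ and $P^-_{y,w}$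 have nonnegative coefficients for all $y,w\in\mathbf I_*$. (B$'$) $P^+_{y,w}-P^+_{z,w}$ and $P^-_{y,w}-P^-_{z,w}$ have nonnegative coefficients for all $y,z,w\in\mathbf I_*$ with $y\le z$. *)

(* Defs.v *)
From HB Require Import structures.
From mathcomp Require Import all_boot all_order all_algebra.
From mathcomp Require Import fraction.
From mathcomp Require Import boolp classical_sets functions cardinality fsbigop.

Set Implicit Arguments.
Unset Strict Implicit.
Unset Printing Implicit Defensive.

Import GRing.Theory.
Local Open Scope classical_set_scope.
Local Open Scope ring_scope.

(* The ring Z[v, v^-1], as the subring of Z(v) = {fraction {poly int}} of the
   elements p / v^n with p : {poly int}. *)

Definition laurent_pred : {pred {fraction {poly int}}} :=
  [pred x | `[< exists (p : {poly int}) (n : nat),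
                  x = tofrac p / tofrac 'X ^+ n >] ].

Lemma laurent_subring_closed : subring_closed laurent_pred.
Proof.
have X0 n : tofrac ('X : {poly int}) ^+ n != 0.
  by rewrite expf_eq0 tofrac_eq0 polyX_eq0 andbF.
have X1 n m : tofrac ('X : {poly int}) ^+ n / tofrac 'X ^+ (n + m) =
              (tofrac 'X ^+ m)^-1.
  by rewrite exprD invfM mulrA divff ?mul1r.
split.
- by apply/asboolP; exists 1, 0%N; rewrite expr0 divr1 tofrac1.
- move=> x y /asboolP/cid[p /cid[n ->]] /asboolP/cid[r /cid[m ->]].
  apply/asboolP; exists (p * 'X^m - r * 'X^n), (n + m)%N.
  rewrite tofracB !tofracM !tofracXn mulrBl -!mulrA X1.
  by rewrite [X in _ ^+ m / _ ^+ X]addnC X1.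
- move=> x y /asboolP/cid[p /cid[n ->]] /asboolP/cid[r /cid[m ->]].
  apply/asboolP; exists (p * r), (n + m)%N.
  by rewrite tofracM exprD invfM mulrACA.
Qed.

HB.instance Definition _ := GRing.isSubringClosed.Build {fraction {poly int}}
  laurent_pred laurent_subring_closed.

Record laurent := Laurent {
  laurent_val :> {fraction {poly int}};
  laurent_valP : laurent_val \in laurent_pred }.

HB.instance Definition _ := [isSub for laurent_val].
HB.instance Definition _ := [Choice of laurent by <:].
HB.instance Definition _ := [SubChoice_isSubComNzRing of laurent by <:].

Lemma vpow_subproof (n : int) : tofrac ('X : {poly int}) ^ n \in laurent_pred.
Proof.
apply/asboolP; case: n => n.
  by exists 'X^n, 0%N; rewrite expr0 divr1 tofracXn.
by exists 1, n.+1; rewrite tofrac1 div1r.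
Qed.

Definition vpow (n : int) : laurent := Laurent (vpow_subproof n).

Definition q : laurent := vpow 2.

Definition at_q (p : {poly int}) : laurent := (map_poly intr p).[q].

Section Coxeter.
Variables (W : groupType) (S : set W).

Definition expressible (w : W) (n : nat) : Prop :=
  exists r : seq W, [/\ size r = n, {in r, forall s, S s}
                      & w = (\prod_(s <- r) s)%g].

(* The last field says that the relations (st)^n = 1 for s, t in S, where n is
   a multiple of the order of st, present W on the generators S. *)
Record coxeter_system : Prop := CoxeterSystem {
  coxeter_gen : forall w, exists n, expressible w n;
  coxeter_neq1 : forall s, S s -> s <> 1%g;
  coxeter_invol : forall s, S s -> (s * s = 1)%g;
  coxeter_pres : forall (G : groupType) (f : W -> G),
    (forall s t n, S s -> S t ->
       ((s * t) ^+ n = 1)%g -> ((f s * f t) ^+ n = 1)%g) ->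
    exists phi : W -> G,
      {morph phi : x y / (x * y)%g} /\ {in S, phi =1 f} }.

Definition len (w : W) : nat :=
  xget 0%N [set n | expressible w n /\
                    forall m, expressible w m -> (n <= m)%N].

Definition reflection (t : W) : Prop :=
  exists s w, S s /\ t = (w * s * w^-1)%g.

Inductive bruhat_le (y : W) : W -> Prop :=
| bruhat_refl : bruhat_le y y
| bruhat_step w t : bruhat_le y w -> reflection t ->
    (len w < len (w * t)%g)%N -> bruhat_le y (w * t)%g.

Definition bruhat_lt (y w : W) : Prop := bruhat_le y w /\ y <> w.

(* b, restricted to D, is a basis of V for the scalar action sc of laurent. *)
Definition basis_on (V : zmodType) (sc : laurent -> V -> V)
    (D : set W) (b : W -> V) : Prop :=
  (forall x, exists (r : seq W) (c : W -> laurent),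
     {in r, forall w, D w} /\ x = \sum_(w <- r) sc (c w) (b w)) /\
  (forall (r : seq W) (c : W -> laurent), uniq r -> {in r, forall w, D w} ->
     \sum_(w <- r) sc (c w) (b w) = 0 -> {in r, forall w, c w = 0}).

(* The Hecke algebra with parameter u: H_q is the case u = q, and H_{q^2} the
   case u = q^2. That t 1 is the unit follows from the other fields as soon as
   S is nonempty. *)
Record hecke_algebra (u : laurent) (H : algType laurent) (t : W -> H) : Prop :=
  HeckeAlgebra {
  hecke_basis : basis_on *:%R setT t;
  hecke_one : t 1%g = 1;
  hecke_up : forall s w, S s -> bruhat_lt w (s * w)%g ->
    t s * t w = t (s * w)%g;
  hecke_down : forall s w, S s -> bruhat_lt (s * w)%g w ->
    t s * t w = u *: t (s * w)%g + (u - 1) *: t w }.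

Record hecke_bar (H : algType laurent) (t : W -> H) (bar : {rmorphism H -> H}) :
  Prop := HeckeBar {
  hecke_barK : involutive bar;
  hecke_bar_v : forall n : int, bar (vpow n)%:A = (vpow (- n))%:A;
  hecke_bar_t : forall w,
    bar (t w) * t w^-1%g = 1 /\ t w^-1%g * bar (t w) = 1 }.

Definition kl_degree_bound (P : W -> W -> {poly int}) (y w : W) : Prop :=
  (2 * (size (P y w)).-1 <= len w - len y - 1)%N.

(* In kl_element and twisted_kl_element the sum runs over the finite support of
   its summand, which lies in the Bruhat interval below w once P y w (resp.
   Ps y w) vanishes for y not <= w. *)
Definition kl_element (H : algType laurent) (t : W -> H)
    (P : W -> W -> {poly int}) (w : W) : H :=
  vpow (- (len w)%:Z) *: \sum_(y \in [set: W]) at_q (P y w) *: t y.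

Record kl_polynomials (H : algType laurent) (t : W -> H) (bar : H -> H)
    (P : W -> W -> {poly int}) : Prop := KLPolynomials {
  kl_bar : forall w, bar (kl_element t P w) = kl_element t P w;
  kl_delta : forall y w, ~ bruhat_lt y w -> P y w = (y == w)%:R;
  kl_degree : forall y w, bruhat_lt y w -> kl_degree_bound P y w }.

Variable star : W -> W.

Record diagram_involution : Prop := DiagramInvolution {
  star_morph : {morph star : x y / (x * y)%g};
  star_invol : involutive star;
  star_S : star @` S = S }.

Definition twisted_involutions : set W := [set w | star w = w^-1%g].

Definition twist (s w : W) : W :=
  if (s * w == w * star s)%g then (s * w)%g else (s * w * star s)%g.

(* The action of laurent on an H-module by restriction of scalars. *)
Definition lscale (H : algType laurent) (M : lmodType H) (c : laurent) (m : M) :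
  M := (c%:A : H) *: m.

Record twisted_module (H : algType laurent) (T : W -> H) (M : lmodType H)
    (a : W -> M) : Prop := TwistedModule {
  twisted_basis : basis_on (@lscale H M) twisted_involutions a;
  twisted_up2 : forall s w, S s -> twisted_involutions w ->
    twist s w = (s * w * star s)%g -> bruhat_lt w (twist s w) ->
    T s *: a w = a (twist s w);
  twisted_up1 : forall s w, S s -> twisted_involutions w ->
    twist s w = (s * w)%g -> bruhat_lt w (twist s w) ->
    T s *: a w = lscale (q + 1) (a (twist s w)) + lscale q (a w);
  twisted_down1 : forall s w, S s -> twisted_involutions w ->
    twist s w = (s * w)%g -> bruhat_lt (twist s w) w ->
    T s *: a w = lscale (q ^+ 2 - q) (a (twist s w))
                 + lscale (q ^+ 2 - q - 1) (a w);
  twisted_down2 : forall s w, S s -> twisted_involutions w ->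
    twist s w = (s * w * star s)%g -> bruhat_lt (twist s w) w ->
    T s *: a w = lscale (q ^+ 2) (a (twist s w)) + lscale (q ^+ 2 - 1) (a w) }.

Record twisted_bar (H : algType laurent) (bar : H -> H) (M : lmodType H)
    (a : W -> M) (barM : {additive M -> M}) : Prop := TwistedBar {
  twisted_barK : involutive barM;
  twisted_bar1 : barM (a 1%g) = a 1%g;
  twisted_barZ : forall h m, barM (h *: m) = bar h *: barM m }.

Definition twisted_kl_element (H : algType laurent) (M : lmodType H)
    (a : W -> M) (Ps : W -> W -> {poly int}) (w : W) : M :=
  lscale (vpow (- (len w)%:Z))
    (\sum_(y \in twisted_involutions) lscale (at_q (Ps y w)) (a y)).

(* Only the values Ps y w at twisted involutions y and w are meaningful. *)
Record twisted_kl_polynomials (H : algType laurent) (M : lmodType H)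
    (a : W -> M) (barM : M -> M) (Ps : W -> W -> {poly int}) : Prop :=
  TwistedKLPolynomials {
  twisted_kl_bar : forall w, twisted_involutions w ->
    barM (twisted_kl_element a Ps w) = twisted_kl_element a Ps w;
  twisted_kl_delta : forall y w, twisted_involutions y ->
    twisted_involutions w -> ~ bruhat_lt y w -> Ps y w = (y == w)%:R;
  twisted_kl_degree : forall y w, twisted_involutions y ->
    twisted_involutions w -> bruhat_lt y w -> kl_degree_bound Ps y w }.

Definition P_plus (P Ps : W -> W -> {poly int}) (y w : W) : {poly rat} :=
  2^-1 *: (map_poly intr (P y w) + map_poly intr (Ps y w)).

Definition P_minus (P Ps : W -> W -> {poly int}) (y w : W) : {poly rat} :=
  2^-1 *: (map_poly intr (P y w) - map_poly intr (Ps y w)).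

Definition nonneg_coefs (p : {poly rat}) : Prop := forall i, 0 <= p`_i.

Definition property_A' (P Ps : W -> W -> {poly int}) : Prop :=
  forall y w, twisted_involutions y -> twisted_involutions w ->
    nonneg_coefs (P_plus P Ps y w) /\ nonneg_coefs (P_minus P Ps y w).

Definition property_B' (P Ps : W -> W -> {poly int}) : Prop :=
  forall y z w, twisted_involutions y -> twisted_involutions z ->
    twisted_involutions w -> bruhat_le y z ->
    nonneg_coefs (P_plus P Ps y w - P_plus P Ps z w) /\
    nonneg_coefs (P_minus P Ps y w - P_minus P Ps z w).

End Coxeter.

(* Main.v *)
Require Import Defs.
From HB Require Import structures.
From mathcomp Require Import all_boot all_order all_algebra.
From mathcomp Require Import fingroup perm zify ring.
From mathcomp Require Import boolp classical_sets functions cardinality fsbigop.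

Set Implicit Arguments.
Unset Strict Implicit.
Unset Printing Implicit Defensive.

Import GRing.Theory.
Local Open Scope classical_set_scope.
Local Open Scope card_scope.
Local Open Scope ring_scope.

(** In a dihedral group the Bruhat order compares lengths: y < w if and only
    if len y < len w. The statement then follows from the fact that, for y
    below w, both [P y w] and [Ps y w] equal 1: the polynomial [P_minus]
    vanishes, and [P_plus y w] is 1 for y below w and 0 otherwise, which
    decreases as y goes up.

    By uniqueness of the Kazhdan-Lusztig elements ([kl_polynomials_trivial]),
    that fact amounts to the bar-invariance of v^-(len w) times the sum of all
    basis elements indexed by y <= w, in the Hecke algebra as well as in the
    module of twisted involutions.

    The index set falls into levels of constant length, a single element at
    the bottom and two elements on each further level. In the Hecke algebra all lengths occur.
    In the module the lengths are 0, 2, 4, and so on if the involution swaps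
    the two generators, and 0, 1, 3, 5, and so on if it is the identity.
    For the generator s that lengthens w, multiplication by T_s + 1 sends the
    sum over the lower ideal of w to the sum for an element one level up, plus
    a multiple of the sum for an element further down ([theta_level_sum]); a
    power of v times T_s + 1 is bar-invariant, so invariance climbs the levels
    ([weight_ideal_sum]). When W
    is finite, its longest element may have a length that is not that of a
    level; it is then joined to the last level by an edge with coefficient
    1 + q, and invariance follows after division by 1 + q ([weight_top]). *)

(** * Alternating words in a dihedral Coxeter group *)

Section Alternating.
Variables (W : groupType) (g : bool -> W).

Fixpoint alt (b : bool) (k : nat) : W :=
  if k is k'.+1 then (g b * alt (~~ b) k')%g else 1%g.

Lemma alt1 b : alt b 1 = g b.
Proof. by rewrite /= mulg1. Qed.

Lemma altD b j k : alt b (j + k) = (alt b j * alt (b (+) odd j) k)%g.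
Proof.
elim: j b => [|j IHj] b; first by rewrite mul1g addbF.
by rewrite addSn /= IHj mulgA addbN addNb.
Qed.

Lemma altSr b k : alt b k.+1 = (alt b k * g (b (+) odd k))%g.
Proof. by rewrite -addn1 altD alt1. Qed.

(** Below a relation [alt true n.*2 = 1] two alternating words are distinct,
    so that [reduced k] says that [k] is at most the order of the product of
    the two generators, whether this order is finite or infinite. *)
Definition reduced (k : nat) : Prop :=
  forall n, (0 < n < k)%N -> alt true n.*2 <> 1%g.

Lemma reduced_le j k : (j <= k)%N -> reduced k -> reduced j.
Proof. by move=> jk rk n /andP[n0 nj]; apply: rk; rewrite n0 (leq_trans nj). Qed.

Hypothesis cox : coxeter_system (range g).
Hypothesis g_inj : injective g.

Let Sg b : range g (g b). Proof. by exists b. Qed.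

Lemma gen_invol b : (g b * g b = 1)%g.
Proof. exact: (coxeter_invol cox). Qed.

Lemma gen_inv b : ((g b)^-1 = g b)%g.
Proof. exact/mulg1_eq/gen_invol. Qed.

Lemma gen_mulK b w : (g b * (g b * w) = w)%g.
Proof. by rewrite mulgA gen_invol mul1g. Qed.

Lemma altV b k : ((alt b k)^-1 = alt (b (+) ~~ odd k) k)%g.
Proof.
elim: k b => [|k IHk] b; first by rewrite invg1.
rewrite [in LHS]/= invgM IHk gen_inv altSr.
by congr (alt _ _ * g _)%g; rewrite /=; case: b; case: (odd k).
Qed.

(** The presentation of W enters through this character: it makes the parity
    of an alternating word depend on its value only, which is what separates
    the words of different lengths below. *)
Lemma sign_character :
  exists sg : W -> bool,
    {morph sg : x y / (x * y)%g >-> x (+) y} /\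
    forall b k, sg (alt b k) = odd k.
Proof.
pose tau : {perm bool} := tperm true false.
have [phi [phiM phiS]] : exists phi : W -> {perm bool},
    {morph phi : x y / (x * y)%g} /\ {in range g, phi =1 fun=> tau}.
  by apply: (coxeter_pres cox) => s t n _ _ _; rewrite tperm2 expg1n.
pose sg w := odd_perm (phi w).
have sgM : {morph sg : x y / (x * y)%g >-> x (+) y}.
  by move=> x y; rewrite /sg phiM odd_permM.
exists sg; split=> // b k; elim: k b => [|k IHk] b.
  by have := sgM 1%g 1%g; rewrite mulg1 /=; case: (sg _).
by rewrite /= sgM IHk /sg phiS ?inE // odd_tperm.
Qed.

Lemma alt_parity b c j k : alt b j = alt c k -> odd j = odd k.
Proof.
have [sg [_ sg_alt]] := sign_character.
by move/(congr1 sg); rewrite !sg_alt.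
Qed.

Lemma alt_double_triv b c n : alt b n.*2 = 1%g -> alt c n.*2 = 1%g.
Proof.
have [-> //|bc] := eqVneq c b.
move/(congr1 (fun x => x^-1)%g); rewrite altV invg1 odd_double addbT.
by case: b c bc => [] [].
Qed.

(** A relation of even length [n.*2] says that the two alternating words of
    length n are equal. *)
Lemma alt_swap b n : alt true n.*2 = 1%g -> alt (~~ b) n = alt b n.
Proof.
move/(alt_double_triv b); rewrite -addnn altD => /mulg1_eq; rewrite altV.
by case: (odd n) b => -[] //= ->.
Qed.

(** Cancelling one of two equal alternating words against the other leaves an
    alternating word for 1, of length the difference or the sum of theirs. *)
Lemma alt_eq b c j k : reduced k -> (j <= k)%N -> alt b k = alt c j ->
  j = k /\ [\/ b = c, k = 0%N | alt true k.*2 = 1%g].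
Proof.
move=> rk jk e; have par := alt_parity e.
have [bc|bc] := eqVneq b c.
  split; last by apply: Or31.
  rewrite -bc in e.
  have : alt (b (+) odd j) (k - j) = 1%g.
    by move: e; rewrite -{1}(subnKC jk) altD -{2}[alt b j]mulg1 => /mulgI.
  have ekj : (k - j = (k - j)./2.*2)%N by rewrite even_halfK // oddB // par addbb.
  rewrite ekj => /(alt_double_triv true) t.
  by apply/eqP; apply: contrapT => /negP jNk; apply: rk t; lia.
have : alt (c (+) ~~ odd j) (j + k) = 1%g.
  rewrite altD -altV; have -> : c (+) ~~ odd j (+) odd j = b.
    by case: b c bc {e} => [] []; case: (odd j).
  by rewrite e mulVg.
have ekj : (j + k = (j + k)./2.*2)%N by rewrite even_halfK // oddD par addbb.
rewrite ekj => /(alt_double_triv true) t.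
have [jek|jNk] := eqVneq j k.
  by split=> //; apply: Or33; move: t; rewrite jek addnn doubleK.
by case: (rk (j + k)./2 _ t); lia.
Qed.

Lemma reducedS k : (0 < k)%N -> reduced k ->
  reduced k.+1 \/ alt true k.*2 = 1%g.
Proof.
move=> k0 rk; have [|tk] := EM (alt true k.*2 = 1%g); [by right|left=> n].
by rewrite ltnS => /andP[n0]; rewrite leq_eqVlt => /orP[/eqP->|nk] //;
  apply: rk; rewrite n0.
Qed.

Lemma reduced2 : reduced 2.
Proof.
move=> [|[|//]] // _ /=; rewrite mulg1 => /mulg1_eq; rewrite gen_inv.
by move/g_inj.
Qed.

Lemma expressible_alt b k : expressible (range g) (alt b k) k.
Proof.
elim: k b => [|k IHk] b; first by exists [::]; split=> //; rewrite big_nil.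
have [r [rk rS rE]] := IHk (~~ b).
exists (g b :: r); split; [by rewrite /= rk | | by rewrite big_cons -rE].
by move=> s; rewrite inE => /orP[/eqP->|/rS].
Qed.

Lemma expressible_mul x y j k : expressible (range g) x j ->
  expressible (range g) y k -> expressible (range g) (x * y)%g (j + k).
Proof.
move=> [r [rj rS ->]] [r' [rk rS' ->]]; exists (r ++ r').
split; [by rewrite size_cat rj rk | | by rewrite big_cat].
by move=> s; rewrite mem_cat => /orP[/rS|/rS'].
Qed.

Lemma expressible_altE w n : expressible (range g) w n ->
  exists b k, (k <= n)%N /\ w = alt b k.
Proof.
move=> [r [<- rS ->]] {n w}; elim: r rS => [|s r IHr] rS.
  by exists true, 0%N; rewrite big_nil.
have [c _ gc] := rS s (mem_head _ _).
have [|b [k [kr rE]]] := IHr; first by move=> x xr; apply: rS; rewrite inE xr orbT.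
rewrite big_cons -gc rE; have [->|bc] := eqVneq b (~~ c).
  by exists c, k.+1.
have {bc} -> : b = c by case: b c bc {rE gc} => [] [].
case: k kr rE => [|k] kr rE; first by exists c, 1%N; rewrite /= mulg1.
by exists (~~ c), k; rewrite /= gen_mulK; split=> //; lia.
Qed.

Notation len := (len (range g)).

Lemma len_spec w :
  expressible (range g) w (len w) /\
  forall n, expressible (range g) w n -> (len w <= n)%N.
Proof.
have ex : exists n, `[< expressible (range g) w n >].
  by have [n wn] := coxeter_gen cox w; exists n; apply/asboolP.
have [n /asboolP wn nmin] := ex_minnP ex.
apply: (xgetPex 0%N (P := [set n | expressible (range g) w n /\
  forall m, expressible (range g) w m -> (n <= m)%N])).
by exists n; split=> // m /asboolP/nmin.
Qed.

Lemma altP w : exists b, w = alt b (len w).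
Proof.
have [wl wmin] := len_spec w; have [b [k [kw wE]]] := expressible_altE wl.
exists b; rewrite {1}wE; congr alt; apply/eqP; rewrite eqn_leq kw /=.
by apply: wmin; rewrite wE; apply: expressible_alt.
Qed.

(** A word reaching past a relation of length [n.*2] is shortened by two when
    its first [n.+1] letters are replaced by their other expression. *)
Lemma reduced_len w : reduced (len w).
Proof.
move=> n /andP[n0 nw] t; have [b wE] := altP w; have [_ wmin] := len_spec w.
suff : expressible (range g) w (n.-1 + (len w - n.+1)) by move/wmin; lia.
rewrite {1}wE -{1}(subnKC nw) altD; apply: expressible_mul; last first.
  exact: expressible_alt.
rewrite /= (alt_swap _ t); case: n n0 {t nw} => // n _.
by rewrite /= gen_mulK; apply: expressible_alt.
Qed.

Lemma len_alt b k : reduced k -> len (alt b k) = k.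
Proof.
move=> rk; have [c bkE] := altP (alt b k).
have [] // := alt_eq rk _ bkE.
by have [_] := len_spec (alt b k); apply; apply: expressible_alt.
Qed.

Lemma reflection_alt b k : odd k -> reflection (range g) (alt b k).
Proof.
move=> ok; have {ok} -> : k = (k./2 + k./2.+1)%N by lia.
set n := k./2; exists (g (b (+) odd n)), (alt b n); split=> //.
by rewrite altV -mulgA altD /= addbN.
Qed.

Lemma bruhat_le_len y w : bruhat_le (range g) y w -> y = w \/ (len y < len w)%N.
Proof.
by elim=> [|v t _ [->|yv] _ vt]; [left | right | right; apply: ltn_trans vt].
Qed.

Lemma odd_lenM x y : odd (len (x * y)%g) = odd (len x) (+) odd (len y).
Proof.
have [sg [sgM sg_alt]] := sign_character.
have sg_len w : sg w = odd (len w) by have [b {1}->] := altP w.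
by rewrite -!sg_len.
Qed.

(** Two elements whose lengths have different parities differ by a reflection,
    since alternating words of odd length are palindromes. *)
Lemma bruhat_step_odd x y w : bruhat_le (range g) x y ->
  odd (len y) != odd (len w) -> (len y < len w)%N -> bruhat_le (range g) x w.
Proof.
move=> xy par yw; rewrite -(mulVKg y w); apply: bruhat_step => //.
  have [d ->] := altP (y^-1 * w)%g; apply: reflection_alt.
  by move: par; rewrite -{1}(mulVKg y w) odd_lenM; case: (odd _); case: (odd _).
by rewrite mulVKg.
Qed.

(** In a dihedral group the Bruhat order is the comparison of lengths: when
    the lengths have the same parity, pass through an element just below the
    longer one. *)
Lemma bruhat_leP y w :
  bruhat_le (range g) y w <-> y = w \/ (len y < len w)%N.
Proof.
split=> [|[->|yw]]; [exact: bruhat_le_len | exact: bruhat_refl | ].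
have [par|par] := eqVneq (odd (len y)) (odd (len w)); last first.
  by apply: bruhat_step_odd par yw; apply: bruhat_refl.
pose z := alt true (len w).-1.
have zl : len z = (len w).-1.
  by apply: len_alt; apply: reduced_le (@reduced_len w); apply: leq_pred.
apply: (@bruhat_step_odd _ z); [|by rewrite zl; lia..].
by apply: bruhat_step_odd (bruhat_refl _ _) _ _; rewrite zl; lia.
Qed.

Lemma bruhat_ltP y w : bruhat_lt (range g) y w <-> (len y < len w)%N.
Proof.
split=> [[/bruhat_leP[->|//] /(_ erefl)]|yw]; first by [].
by split; [apply/bruhat_leP; right | move=> e; rewrite e ltnn in yw].
Qed.

End Alternating.

(** * Laurent polynomials *)

Lemma vpowD m n : vpow (m + n) = vpow m * vpow n.
Proof.
by apply: val_inj; rewrite rmorphM /= expfzDr // tofrac_eq0 polyX_eq0.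
Qed.

Lemma vpow0 : vpow 0 = 1.
Proof. exact: val_inj. Qed.

Lemma vpow_nat n k : vpow n ^+ k = vpow (n * k%:Z).
Proof.
elim: k => [|k IHk]; first by rewrite mulr0 vpow0.
by rewrite exprS IHk -vpowD; congr vpow; lia.
Qed.

Lemma q_exp k : q ^+ k = vpow (2 * k)%:Z.
Proof. by rewrite vpow_nat -PoszM. Qed.

Lemma at_qE : at_q = horner_eval q \o map_poly intr.
Proof. by []. Qed.

Lemma at_q_sum p : at_q p = \sum_(i < size p) (p`_i)%:~R * vpow (2 * i)%:Z.
Proof.
rewrite /at_q (@horner_coef_wide _ (size p)) ?size_poly //.
by apply: eq_bigr => i _; rewrite coef_map q_exp.
Qed.

Lemma at_q_inj : injective at_q.
Proof.
have fracC (c : int) : tofrac c%:P = c%:~R.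
  by have -> : c%:P = c%:~R :> {poly int}; rewrite ?rmorph_int // -{1}(intz c) rmorph_int.
have valE p : val (at_q p) = tofrac (p \Po 'X^2).
  rewrite at_q_sum comp_polyE !rmorph_sum; apply: eq_bigr => i _.
  by rewrite rmorphM rmorph_int /= -exprM -mul_polyC tofracM fracC tofracXn.
move=> p r /(congr1 val); rewrite !valE => /eqP; rewrite tofrac_eq => /eqP e.
apply/polyP => i; have := congr1 (fun u : {poly int} => u`_(i * 2)) e.
by rewrite !coef_comp_poly_Xn // dvdn_mull // mulnK.
Qed.

(** The conjugate of [at_q p] under v |-> v^-1. *)
Definition at_qV (p : {poly int}) : laurent :=
  \sum_(i < size p) (p`_i)%:~R * vpow (- (2 * i)%:Z).

(** The degree bound on one side and its image under v |-> v^-1 on the other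
    leave no common exponent of v. *)
Lemma self_conjugate_eq0 (p : {poly int}) (n : nat) :
  (2 * (size p).-1 < n)%N -> at_q p = at_qV p * vpow (2 * n)%:Z -> p = 0.
Proof.
move=> szp e; have [->//|p0] := eqVneq p 0.
have lt_n (i : 'I_(size p)) : (2 * i < n)%N.
  by apply: leq_ltn_trans szp; rewrite leq_mul2l -ltnS prednK ?size_poly_gt0 //=.
pose r : {poly int} := \sum_(i < size p) p`_i *: 'X^(n - i).
have pE : p = r.
  apply: at_q_inj; rewrite e /r at_qE rmorph_sum /= mulr_suml.
  apply: eq_bigr => i _; rewrite map_polyZ map_polyXn /horner_eval hornerZ hornerXn.
  rewrite -mulrA -vpowD q_exp; congr (_ * vpow _).
  by have := lt_n i; move: (nat_of_ord i) => j; clear; lia.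
have : lead_coef p == 0.
  rewrite lead_coefE (congr1 (fun u : {poly int} => u`_(size p).-1) pE) coef_sum big1 // => i _.
  rewrite coefZ coefXn; case: eqP => [ei|_]; last by rewrite mulr0.
  by have := lt_n i; move: szp; rewrite ei; lia.
by rewrite lead_coef_eq0 (negbTE p0).
Qed.

(** * Coordinates and uniqueness of bar-invariant elements *)

Section Coordinates.
Variables (W : groupType) (V : lmodType laurent) (D : set W) (b : W -> V).
Hypothesis b_basis : basis_on *:%R D b.

(** The list of indices in a span may have repetitions, whose coefficients
    add up. *)
Let total (r : seq W) (c : W -> laurent) (y : W) : laurent :=
  \sum_(z <- r | z == y) c z.

Let totalE (r r' : seq W) c : uniq r' -> {subset r <= r'} ->
  \sum_(z <- r) c z *: b z = \sum_(y <- r') total r c y *: b y.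
Proof.
move=> r'U rr'; under [RHS]eq_bigr => y _ do rewrite scaler_suml big_mkcond.
rewrite exchange_big /=; apply: eq_big_seq => z /rr' zr'.
rewrite (bigD1_seq z) //= eqxx big1 ?addr0 // => y.
by rewrite eq_sym => /negbTE->.
Qed.

Let total_linear (k : laurent) r1 c1 r2 c2 r3 c3 :
  {in r1 ++ r2 ++ r3, forall w, D w} ->
  k *: (\sum_(z <- r1) c1 z *: b z) + \sum_(z <- r2) c2 z *: b z
    = \sum_(z <- r3) c3 z *: b z ->
  forall y, k * total r1 c1 y + total r2 c2 y = total r3 c3 y.
Proof.
move=> rD e y; pose r := undup (r1 ++ r2 ++ r3).
have rU : uniq r by apply: undup_uniq.
have sub s : {subset s <= r1 ++ r2 ++ r3} -> {subset s <= r}.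
  by move=> sr z /sr; rewrite mem_undup.
have total0 s c : {subset s <= r} -> y \notin r -> total s c y = 0.
  move=> sr yr; rewrite /total big_seq_cond big1 // => z /andP[/sr zr /eqP zy].
  by rewrite zy (negbTE yr) in zr.
have s1 : {subset r1 <= r} by apply: sub => z; rewrite mem_cat => ->.
have s2 : {subset r2 <= r} by apply: sub => z; rewrite !mem_cat => ->; rewrite orbT.
have s3 : {subset r3 <= r} by apply: sub => z; rewrite !mem_cat => ->; rewrite !orbT.
have [yr|yr] := boolP (y \in r); last by rewrite !total0 // mulr0 addr0.
apply/eqP; rewrite -subr_eq0; apply/eqP.
pose c z := k * total r1 c1 z + total r2 c2 z - total r3 c3 z.
have [_ b_free] := b_basis; apply: (b_free r c rU _ _ y yr).
  by move=> w; rewrite mem_undup => /rD.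
under eq_bigr => z _ do rewrite scalerBl scalerDl -scalerA.
rewrite sumrB big_split /= -scaler_sumr -(totalE _ rU s1) -(totalE _ rU s2).
by rewrite -(totalE _ rU s3) e subrr.
Qed.

Lemma coordinates : exists phi : W -> {scalar V},
  (forall y z, D z -> phi y (b z) = (z == y)%:R) /\
  (forall x, (forall y, D y -> phi y x = 0) -> x = 0).
Proof.
have [b_span _] := b_basis.
have /choice[r /choice[c rcE]] : forall x, exists r c,
    {in r, forall w, D w} /\ x = \sum_(w <- r) c w *: b w by apply: b_span.
have rD x : {in r x, forall w, D w} by have [] := rcE x.
have xE x : x = \sum_(w <- r x) c x w *: b w by have [] := rcE x.
have phiL y : scalar (fun x => total (r x) (c x) y).
  move=> k x z; symmetry; apply: total_linear; last by rewrite -!xE.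
  by move=> w; rewrite !mem_cat => /or3P[] /rD.
pose phi y : {scalar V} := HB.pack (fun x => total (r x) (c x) y)
  (GRing.isLinear.Build laurent V laurent *%R _ (phiL y)).
exists phi; split=> [y z Dz|x phi0].
- change (total (r (b z)) (c (b z)) y = (z == y)%:R).
  have <- : 0 * total [::] (fun=> 0) y + total [:: z] (fun=> 1) y
      = total (r (b z)) (c (b z)) y.
    apply: total_linear => [w|]; last by rewrite scale0r add0r big_seq1 scale1r -xE.
    by rewrite inE => /orP[/eqP->|/rD].
  by rewrite mul0r add0r /total big_mkcond big_seq1; case: eqP.
- rewrite (xE x) (totalE _ (undup_uniq (r x))); last first.
    by move=> z; rewrite mem_undup.
  rewrite big_seq big1 // => y; rewrite mem_undup => /rD/phi0 y0.
  by rewrite (y0 : total _ _ _ = 0) scale0r.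
Qed.

(** The free module has no torsion for 1 + q, as Z(v) is a field. *)
Lemma scale_1q_inj (x y : V) : (1 + q) *: x = (1 + q) *: y -> x = y.
Proof.
move=> e; apply/eqP; rewrite -subr_eq0; apply/eqP.
have [phi [_ phi_inj]] := coordinates.
apply: phi_inj => z _; have : (1 + q) * phi z (x - y) = 0.
  by rewrite -linearZ scalerBr e subrr linear0.
move/(congr1 val); rewrite rmorphM rmorph0 => /eqP; rewrite mulf_eq0.
case/orP => [/eqP q0|/eqP z0]; last exact: val_inj.
have : tofrac (1 + 'X^2 : {poly int}) = 0.
  by rewrite tofracD tofracXn tofrac1; exact: q0.
move/eqP; rewrite tofrac_eq0 addrC -[1]/(1%:P) -size_poly_eq0.
by rewrite size_XnaddC.
Qed.

End Coordinates.

Section Uniqueness.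
Variables (V : lmodType laurent) (bar : V -> V).
Hypotheses (barD : {morph bar : x y / x + y})
  (barZ : forall n x, bar (vpow n *: x) = vpow (- n) *: bar x).

(** For x of weight k, the element [vpow (- k) *: x] is bar-invariant. *)
Definition weight (k : nat) (x : V) : Prop :=
  bar x = vpow (- (2 * k)%:Z) *: x.

Lemma bar0 : bar 0 = 0.
Proof. by apply: (addrI (bar 0)); rewrite -barD !addr0. Qed.

Lemma barN x : bar (- x) = - bar x.
Proof. by apply/eqP; rewrite -addr_eq0 -barD addNr bar0. Qed.

Lemma bar_sum (I : Type) (r : seq I) (F : I -> V) :
  bar (\sum_(i <- r) F i) = \sum_(i <- r) bar (F i).
Proof. exact: (big_morph bar barD bar0). Qed.

Lemma bar_at_q p x : bar (at_q p *: x) = at_qV p *: bar x.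
Proof.
rewrite at_q_sum /at_qV !scaler_suml bar_sum; apply: eq_bigr => i _.
rewrite -!scalerA -barZ; set y := _ *: x; case: (p`_i) => n.
  by rewrite -!pmulrn !scaler_nat; elim: n => [|n IHn]; rewrite ?bar0 // !mulrS barD IHn.
rewrite NegzE !mulrNz -!pmulrn !scaleNr barN !scaler_nat; congr (- _).
by elim: n.+1 => [|m IHm]; rewrite ?bar0 // !mulrS barD IHm.
Qed.

Lemma weightD k x y : weight k x -> weight k y -> weight k (x + y).
Proof. by rewrite /weight barD scalerDr => -> ->. Qed.

Lemma weightN k x : weight k x -> weight k (- x).
Proof. by rewrite /weight barN scalerN => ->. Qed.

Lemma weightB k x y : weight k x -> weight k y -> weight k (x - y).
Proof. by move=> wx wy; apply/weightD/weightN. Qed.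

Lemma weight_vpow k n x : weight k x ->
  weight (k + 2 * n) (vpow (2 * n)%:Z *: x).
Proof.
by rewrite /weight barZ => ->; rewrite !scalerA -!vpowD; congr (vpow _ *: _); lia.
Qed.

Lemma weight_invariant k x :
  bar (vpow (- k%:Z) *: x) = vpow (- k%:Z) *: x -> weight k x.
Proof.
rewrite barZ opprK /weight => e.
have -> : bar x = vpow (- k%:Z) *: (vpow k *: bar x).
  by rewrite scalerA -vpowD addNr vpow0 scale1r.
by rewrite e scalerA -vpowD; congr (vpow _ *: _); lia.
Qed.

Variables (W : groupType) (D : set W) (b : W -> V) (ln : W -> nat).
Variable below : W -> seq W.
Hypothesis b_basis : basis_on *:%R D b.
Hypothesis below_uniq : forall w, D w -> uniq (below w).
Hypothesis belowP : forall w, D w ->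
  forall y, y \in below w <-> D y /\ (ln y < ln w)%N.
Hypothesis weight_below : forall w, D w ->
  weight (ln w) (b w + \sum_(y <- below w) b y).

(** If the sum over each lower ideal has the weight of its top element, then
    these sums are, up to powers of v, the elements of the Kazhdan-Lusztig
    basis. The bar operator being triangular, a discrepancy at an index y of
    maximal length would be a self-conjugate multiple of [b y], which the
    degree bound excludes. *)
Lemma kl_polynomials_trivial (P : W -> {poly int}) w : D w ->
  let x := vpow (- (ln w)%:Z) *: \sum_(y \in D) at_q (P y) *: b y in
  bar x = x -> P w = 1 ->
  (forall y, D y -> y <> w -> ~~ (ln y < ln w)%N -> P y = 0) ->
  (forall y, D y -> (ln y < ln w)%N ->
     (2 * (size (P y)).-1 <= ln w - ln y - 1)%N) ->
  forall y, D y -> (ln y < ln w)%N -> P y = 1.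
Proof.
move=> Dw /= /weight_invariant wx Pw P0 Pdeg.
have [phi [phib _]] := coordinates b_basis.
(* The bar operator is triangular, with [vpow (- (2 * ln y))] on the diagonal:
   [weight_below] expresses [bar (b z)] by [b z] and shorter elements. *)
have phi_bar y z : D y -> D z -> (ln z <= ln y)%N ->
    phi y (bar (b z)) = (z == y)%:R * vpow (- (2 * ln y)%:Z).
  move=> Dy; elim: {z}(ln z).+1 {-2}z (ltnSn (ln z)) => // n IHn z zn Dz zy.
  have zN : {in below z, forall u, phi y (b u) = 0 /\ phi y (bar (b u)) = 0}.
    move=> u /(belowP Dz)[Du uz].
    have uy : (u == y) = false by apply/eqP => uy; rewrite uy in uz; lia.
    by rewrite phib // IHn ?uy ?mul0r //; lia.
  move/(congr1 (phi y)): (weight_below Dz).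
  rewrite barD bar_sum linearZ !linearD !linear_sum big_seq big1 => [|u /zN[]//].
  rewrite [X in _ = _ * (_ + X)]big_seq big1 => [|u /zN[]//].
  rewrite !addr0 phib // => ->; case: eqP => [->|_]; last by rewrite mulr0 mul0r.
  by rewrite mulr1 mul1r.
pose d y := P y - 1.
have xE : \sum_(y \in D) at_q (P y) *: b y = b w + \sum_(y <- below w) at_q (P y) *: b y.
  have at_q1 : at_q 1 = 1 by rewrite at_qE rmorph1.
  have at_q0 : at_q 0 = 0 by rewrite at_qE rmorph0.
  rewrite (fsbigE (w :: below w)) /=.
  - rewrite big_cons mem_set // Pw at_q1 scale1r big_seq_cond [in RHS]big_seq.
    congr (_ + _); apply: eq_bigl => u; apply: andb_idr => /(belowP Dw)[Du _].
    exact: mem_set.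
  - rewrite below_uniq // andbT; apply/negP => /(belowP Dw)[_].
    by rewrite ltnn.
  - by move=> u /=; rewrite inE => /orP[/eqP->|/(belowP Dw)[]].
  - move=> u Du; rewrite inE negb_or => /andP[/eqP uw ub].
    rewrite P0 ?at_q0 ?scale0r //; apply: contra ub => uw'.
    by apply/(belowP Dw).
have dE : weight (ln w) (\sum_(y <- below w) at_q (d y) *: b y).
  have -> : \sum_(y <- below w) at_q (d y) *: b y =
      \sum_(y \in D) at_q (P y) *: b y - (b w + \sum_(y <- below w) b y).
    rewrite xE opprD addrACA subrr add0r -sumrB; apply: eq_bigr => u _.
    by rewrite /d !at_qE rmorphB rmorph1 scalerBl scale1r.
  exact: weightB (weight_below Dw).
suff d0 n y : D y -> (ln y < ln w)%N -> (ln w - ln y <= n)%N -> d y = 0.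
  by move=> y Dy yw; apply/eqP; rewrite -subr_eq0; apply/eqP/(d0 _ y Dy yw (leqnn _)).
elim: n y => [|n IHn] y Dy yw yn; first lia.
apply: (@self_conjugate_eq0 _ (ln w - ln y)).
  have : (size (d y) <= maxn (size (P y)) 1)%N.
    by apply: leq_trans (size_polyD _ _) _; rewrite size_polyN size_poly1.
  by move: (Pdeg y Dy yw); move: (size (d y)) (size (P y)) => m n'; lia.
have yb : y \in below w by apply/belowP.
have sum_y (F : W -> laurent) :
    {in below w, forall u, u != y -> F u = 0} -> \sum_(u <- below w) F u = F y.
  move=> F0; rewrite (bigD1_seq y) ?below_uniq //= big_seq_cond big1 ?addr0 //.
  by move=> u /andP[/F0].
have e : at_qV (d y) * vpow (- (2 * ln y)%:Z) = vpow (- (2 * ln w)%:Z) * at_q (d y).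
  move: dE; rewrite /weight bar_sum => /(congr1 (phi y)).
  rewrite linearZ /= !linear_sum !sum_y => [|u|u].
  - by rewrite bar_at_q !linearZ /= phi_bar // phib // eqxx mul1r mulr1.
  - by move=> /(belowP Dw)[Du uw] uy; rewrite linearZ /= phib // (negbTE uy) mulr0.
  - move=> /(belowP Dw)[Du uw] uy; rewrite bar_at_q linearZ /=.
    have [uly|ylu] := leqP (ln u) (ln y).
      by rewrite phi_bar // (negbTE uy) mul0r mulr0.
    by rewrite IHn //; [rewrite /at_qV size_poly0 big_ord0 mul0r|lia].
have -> : at_q (d y) = vpow (2 * ln w)%:Z * (vpow (- (2 * ln w)%:Z) * at_q (d y)).
  by rewrite mulrA -vpowD subrr vpow0 mul1r.
by rewrite -e mulrCA -vpowD; congr (_ * vpow _); lia.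
Qed.

End Uniqueness.

(** * The recursion along the levels *)

Section Ladder.
Variables (V : lmodType laurent) (bar : V -> V).
Hypotheses (barD : {morph bar : x y / x + y})
  (barZ : forall n x, bar (vpow n *: x) = vpow (- n) *: bar x).
Notation weight := (weight bar).

Hypothesis scale_inj : forall x y : V, (1 + q) *: x = (1 + q) *: y -> x = y.

Lemma weight_div1q k x : weight k.+1 ((1 + q) *: x) -> weight k x.
Proof.
rewrite /weight scalerDl scale1r barD barZ => e; apply: scale_inj.
have -> : (1 + q) *: bar x = q *: (bar x + vpow (- 2) *: bar x).
  by rewrite scalerDr scalerA -vpowD subrr vpow0 scale1r addrC scalerDl scale1r.
rewrite e -{1}(scale1r x) -scalerDl !scalerA; congr (_ *: _).
by rewrite -vpowD mulrC; congr (_ * vpow _); lia.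
Qed.

Variables (d : nat) (theta : bool -> V -> V).
Let u := vpow (2 * d)%:Z.
Hypotheses (thetaD : forall c, {morph theta c : x y / x + y})
  (bar_theta : forall c x, bar (theta c x) = vpow (- (2 * d)%:Z) *: theta c (bar x))
  (thetaZ : forall c a x, theta c (a *: x) = a *: theta c x).

Lemma weight_theta c k x : weight k x -> weight (k + d) (theta c x).
Proof.
rewrite /weight bar_theta => ->; rewrite thetaZ scalerA -vpowD.
by congr (vpow _ *: _); lia.
Qed.

(* Level 0 is the single vector [e]; level i > 0 consists of the two vectors
   [x c i], and [ell i] is the length of level i. The operator [theta c] joins
   level i to level i.+1 by edges from [x (~~ c) i] to [x c i.+1], with
   eigenvalue [1 + u] on the sum of the two ends. The edges at the bottom have
   coefficient [kappa], either 1 or 1 + q. *)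
Variables (e : V) (x : bool -> nat -> V) (ell : nat -> nat) (N : nat).
Variable kappa : laurent.

Fixpoint level_sum (i : nat) : V :=
  if i is j.+1 then level_sum j + (x true j.+1 + x false j.+1) else e.

(** [x c i.+1] is comparable to all elements of lower levels, but not to the
    other element of its own level. *)
Definition ideal_sum (c : bool) (i : nat) : V := x c i.+1 + level_sum i.

Hypotheses
  (theta_up : forall c i, (i.+1 < N)%N ->
     theta c (x (~~ c) i.+1) = x (~~ c) i.+1 + x c i.+2)
  (theta_down : forall c i, (i.+1 < N)%N ->
     theta c (x c i.+2) = u *: (x (~~ c) i.+1 + x c i.+2))
  (theta_base_up : forall c, theta c e = kappa *: (e + x c 1%N))
  (theta_base_down : forall c,
     theta c (x c 1%N) = (1 + u - kappa) *: (e + x c 1%N))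
  (ellSS : forall i, ell i.+2 = (ell i.+1 + d)%N).

Lemma level_sumS c i :
  level_sum i.+1 = level_sum i + (x c i.+1 + x (~~ c) i.+1).
Proof. by case: c => //=; rewrite [x false _ + _]addrC. Qed.

Lemma ideal_sumS c i :
  ideal_sum c i.+1 = ideal_sum c i + (x (~~ c) i.+1 + x c i.+2).
Proof.
rewrite /ideal_sum (level_sumS c) [RHS]addrA [RHS]addrC; congr (_ + _).
by rewrite addrA [level_sum i + _]addrC.
Qed.

Definition lower_term (c : bool) (i : nat) : V :=
  if i is j.+1 then u *: ideal_sum c j else (kappa - 1) *: ideal_sum c 0.

(** The edges of [theta c] pair off the elements of level at most i, except
    that the edge of [x (~~ c) i] (of [e] if i = 0) leads to [x c i.+1]. On a
    complete pair the eigenvalue is [1 + u], of which the summand 1 contributes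
    to the ideal sum of [x c i.+1] and the summand [u] to the lower term; for
    i = 0 the lower term is the excess of [kappa] over 1. *)
Lemma theta_level_sum c i : (i < N)%N ->
  theta c (level_sum i) = ideal_sum c i + lower_term c i.
Proof.
elim: i => [|i IHi] iN.
  by rewrite theta_base_up /= scalerBl scale1r [RHS]addrC subrK [e + _]addrC.
have lowerE : lower_term c i + theta c (x c i.+1) = u *: ideal_sum c i.
  case: i iN {IHi} => [|i] iN.
    rewrite theta_base_down /ideal_sum [e + _]addrC -scalerDl.
    by congr (_ *: _); rewrite addrC addrA addrNK; ring.
  by rewrite theta_down -?scalerDr -?ideal_sumS // ltnW.
rewrite (level_sumS c) !thetaD IHi ?(ltnW iN) // theta_up // ideal_sumS.
by rewrite [theta c (x c _) + _]addrC addrACA lowerE.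
Qed.

Hypothesis weight_base : forall c, weight (ell 1) (ideal_sum c 0).
Hypothesis weight_lower0 : forall c, weight (ell 1 + d) (lower_term c 0).

(** The image of [x (~~ c) i.+1] is left as it is, because its form depends
    on whether level i.+1 is the last one. *)
Let weight_step i : (i < N)%N ->
  (forall c, weight (ell i.+1) (ideal_sum c i)) ->
  (forall c, weight (ell i.+1 + d) (lower_term c i)) ->
  forall c, weight (ell i.+1 + d) (ideal_sum c i + theta c (x (~~ c) i.+1)).
Proof.
move=> iN wI wL c.
have -> : ideal_sum c i + theta c (x (~~ c) i.+1) =
    theta c (ideal_sum (~~ c) i) - lower_term c i.
  by rewrite {2}/ideal_sum thetaD theta_level_sum // addrA addrK addrC.
by apply: weightB => //; apply: weight_theta.
Qed.

Let weight_pair i : (i < N)%N ->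
  (forall c, weight (ell i.+1) (ideal_sum c i)) /\
  (forall c, weight (ell i.+1 + d) (lower_term c i)).
Proof.
elim: i => [|i IHi] iN; first by [].
have [wI wL] := IHi (ltnW iN); split=> c; rewrite ellSS.
  by have := weight_step (ltnW iN) wI wL c; rewrite theta_up // -ideal_sumS.
by rewrite -addnA addnn -mul2n; apply: weight_vpow.
Qed.

Lemma weight_ideal_sum c i : (i < N)%N -> weight (ell i.+1) (ideal_sum c i).
Proof. by move=> iN; have [] := weight_pair iN. Qed.

(** Here z stands for a longest element whose length is one more than that of
    the last level. The edges to it have coefficient 1 + q, and the element of
    [weight_step] falls short of 1 + q times its ideal sum by q times an ideal
    sum of the last level. *)
Lemma weight_top c i z : (i < N)%N -> d = 2%N ->
  theta c (x (~~ c) i.+1) = (1 + q) *: (x (~~ c) i.+1 + z) ->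
  weight (ell i.+1).+1 (z + level_sum i.+1).
Proof.
move=> iN d2 theta_z; apply: weight_div1q; have [wI wL] := weight_pair iN.
have -> : (1 + q) *: (z + level_sum i.+1) =
    (ideal_sum c i + theta c (x (~~ c) i.+1)) + q *: ideal_sum c i.
  rewrite theta_z addrAC -{1}[ideal_sum c i]scale1r -scalerDl -scalerDr.
  congr (_ *: _); rewrite (level_sumS c) /ideal_sum addrC.
  by rewrite addrA -addrA [level_sum i + _]addrC.
apply: weightD => //; first by rewrite -addn2 -d2; apply: weight_step.
by rewrite -addn2; apply: (weight_vpow barZ 1).
Qed.

End Ladder.

(** * Lower ideals as unions of levels *)

Section Levels.
Variables (W : groupType) (g : bool -> W).
Hypothesis cox : coxeter_system (range g).
Notation len := (len (range g)).

Lemma alt_neq b k : (0 < k)%N -> reduced g k.+1 -> alt g b k <> alt g (~~ b) k.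
Proof.
move=> k0 rk e; have [_ []] := alt_eq cox (reduced_le (leqnSn k) rk) (leqnn k) e.
- by case: (b).
- by move=> k00; rewrite k00 in k0.
- by apply: rk; rewrite k0 ltnSn.
Qed.

Variables (D : set W) (ell : nat -> nat).
Hypotheses (ell0 : ell 0 = 0%N) (ellS : forall i, (ell i < ell i.+1)%N).

(** The assumption [reduced g k.+1] leaves out the longest element of a finite
    W, which may lie in D whatever its length. *)
Hypothesis Dlevel : forall b k i, reduced g k.+1 -> (ell i <= k < ell i.+1)%N ->
  D (alt g b k) <-> k = ell i.

Let len_level y i : D y -> reduced g (len y).+1 ->
  (ell i <= len y < ell i.+1)%N -> len y = ell i.
Proof. by have [b {1}->] := altP cox y => Dy ry yi; apply/(Dlevel b ry yi). Qed.

Fixpoint level_list (i : nat) : seq W :=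
  if i is j.+1 then [:: alt g true (ell j.+1), alt g false (ell j.+1) & level_list j]
  else [:: 1%g].

Lemma level_listP i : reduced g (ell i).+1 ->
  uniq (level_list i) /\
  forall y, y \in level_list i <-> D y /\ (len y <= ell i)%N.
Proof.
elim: i => [|i IHi] ri.
  split=> // y; rewrite inE ell0; split=> [/eqP->|[_]].
    have r0 : reduced g 0 by apply: reduced_le ri.
    rewrite -[1%g]/(alt g true 0) (len_alt cox) //; split=> //.
    have r1 : reduced g 1 by rewrite ell0 in ri.
    have i1 : (ell 0 <= 0 < ell 1)%N by rewrite {1}ell0 (leq_ltn_trans _ (ellS 0)).
    by apply/(Dlevel true r1 i1); rewrite ell0.
  by rewrite leqn0 => /eqP y0; have [b ->] := altP cox y; rewrite y0.
have rl : reduced g (ell i.+1) by apply: reduced_le ri.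
have [U memP] := IHi (reduced_le (ellS i) rl).
have lenE b : len (alt g b (ell i.+1)) = ell i.+1 by apply: len_alt.
have notin b : alt g b (ell i.+1) \notin level_list i.
  by apply/negP => /memP[_]; rewrite lenE leqNgt ellS.
split=> [|y].
  rewrite /= inE negb_or !notin U !andbT.
  by apply/eqP/(@alt_neq true) => //; apply: leq_trans (ellS i).
have Dl b : D (alt g b (ell i.+1)) by apply/(@Dlevel _ _ i.+1); rewrite ?leqnn ?ellS.
split=> [|[Dy]].
  rewrite /= !inE => /or3P[/eqP->|/eqP->|/memP[Dy yi]]; rewrite ?lenE //.
  by split=> //; apply: leq_trans yi (ltnW (ellS i)).
have [b yE] := altP cox y; rewrite leq_eqVlt => /orP[/eqP ye|yl].
  by rewrite yE ye /= !inE; case: b {yE}; rewrite eqxx ?orbT.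
rewrite /= !inE; apply/or3P/Or33/memP; split=> //; rewrite leqNgt; apply/negP => iy.
have yi : len y = ell i.
  by apply: len_level => //; [apply: reduced_le rl | rewrite (ltnW iy)].
by rewrite yi ltnn in iy.
Qed.

Lemma ell_ge i : (i <= ell i)%N.
Proof. by elim: i => // i IHi; apply: leq_ltn_trans IHi (ellS i). Qed.

Lemma ell_between k : (0 < k)%N -> exists i, (ell i < k <= ell i.+1)%N.
Proof.
move=> k0; have ex : exists i, (k <= ell i)%N by exists k; apply: ell_ge.
case: (ex_minnP ex) => [[|i]]; first by rewrite ell0 leqNgt k0.
move=> ki imin; exists i; rewrite ki andbT ltnNge.
by apply/negP => /imin; rewrite ltnn.
Qed.

Variables (V : lmodType laurent) (b : W -> V).

Lemma level_list_sum i :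
  \sum_(y <- level_list i) b y =
  level_sum (b 1%g) (fun c j => b (alt g c (ell j))) i.
Proof.
elim: i => [|i IHi]; first by rewrite big_seq1.
by rewrite /= !big_cons IHi addrA addrC.
Qed.

Variables (bar : V -> V).
Hypotheses (weight1 : weight bar 0 (b 1%g))
  (weight_level : forall c i, reduced g (ell i.+1) -> weight bar (ell i.+1)
     (ideal_sum (b 1%g) (fun c j => b (alt g c (ell j))) c i))
  (weight_longest : forall w i, D w -> (ell i < len w < ell i.+1)%N ->
     weight bar (len w) (b w + level_sum (b 1%g) (fun c j => b (alt g c (ell j))) i)).

Lemma lower_ideals : exists below : W -> seq W,
  [/\ forall w, D w -> uniq (below w),
      forall w, D w -> forall y, y \in below w <-> D y /\ (len y < len w)%N
    & forall w, D w -> weight bar (len w) (b w + \sum_(y <- below w) b y)].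
Proof.
suff /choice[below belowE] w : exists s : seq W, D w ->
    [/\ uniq s, forall y, y \in s <-> D y /\ (len y < len w)%N
      & weight bar (len w) (b w + \sum_(y <- s) b y)].
  by exists below; split=> w /belowE[].
have [c wE] := altP cox w; have [w0|w_gt0] := posnP (len w).
  exists [::] => _; split=> // [y|]; first by rewrite w0; split=> // -[].
  by rewrite big_nil addr0 w0 wE w0.
have [i /andP[iw wi]] := ell_between w_gt0; exists (level_list i) => Dw.
have [U memP] := level_listP (reduced_le iw (reduced_len cox (w := w))).
split=> // [y|].
  rewrite memP; split=> -[Dy]; first by move=> yi; split=> //; apply: leq_ltn_trans iw.
  move=> yw; split=> //; rewrite leqNgt; apply/negP => iy.
  have yi : len y = ell i.
    apply: len_level => //; last by rewrite (ltnW iy) (leq_trans yw).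
    exact: reduced_le yw (reduced_len cox (w := w)).
  by rewrite yi ltnn in iy.
rewrite level_list_sum; move: wi; rewrite leq_eqVlt => /orP[/eqP wi|wi].
  have := @weight_level c i; rewrite -wi /ideal_sum -wi -wE; apply.
  exact: reduced_len.
by apply: weight_longest => //; rewrite iw.
Qed.

End Levels.

(** * Hecke algebras *)

Section Hecke.
Variables (W : groupType) (g : bool -> W).
Hypotheses (cox : coxeter_system (range g)) (g_inj : injective g).
Notation len := (len (range g)).
Variables (d : nat) (H : algType laurent) (t : W -> H) (bar : {rmorphism H -> H}).
Let u := vpow (2 * d)%:Z.
Hypotheses (heckeH : hecke_algebra (range g) u t) (barH : hecke_bar t bar).

Let Sg b : range g (g b). Proof. by exists b. Qed.

Lemma bar_vpowZ n (x : H) : bar (vpow n *: x) = vpow (- n) *: bar x.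
Proof. by rewrite -mulr_algl rmorphM (hecke_bar_v barH) mulr_algl. Qed.

Lemma mul_gen_up c w : (len w < len (g c * w)%g)%N ->
  (t (g c) + 1) * t w = t w + t (g c * w)%g.
Proof.
by move=> lt; rewrite mulrDl mul1r (hecke_up heckeH) 1?addrC //; apply/bruhat_ltP.
Qed.

Lemma mul_gen_down c w : (len w < len (g c * w)%g)%N ->
  (t (g c) + 1) * t (g c * w)%g = u *: (t w + t (g c * w)%g).
Proof.
move=> lt; rewrite mulrDl mul1r (hecke_down heckeH) ?gen_mulK //; last exact/bruhat_ltP.
by rewrite -addrA scalerBl scale1r subrK scalerDr.
Qed.

Lemma len_gen c : (len 1%g < len (g c * 1)%g)%N.
Proof.
have r1 : reduced g 1 by apply: reduced_le (reduced2 cox g_inj).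
by rewrite -[(_ * _)%g]/(alt g c 1) -[1%g]/(alt g c 0) !(len_alt cox) //; apply: reduced_le r1.
Qed.

(** Equivalently, [v^-d (t_s + 1)] is bar-invariant. *)
Lemma bar_gen c : bar (t (g c) + 1) = vpow (- (2 * d)%:Z) *: (t (g c) + 1).
Proof.
have [barl barr] := hecke_bar_t barH (g c); rewrite (gen_inv cox) in barl barr.
suff e : bar (t (g c) + 1) * t (g c) = vpow (- (2 * d)%:Z) *: (t (g c) + 1) * t (g c).
  by have /= := congr1 ( *%R^~ (bar (t (g c)))) e; rewrite -!mulrA barr !mulr1.
have := mul_gen_down (len_gen c); rewrite mulg1 (hecke_one heckeH) => e.
rewrite rmorphD rmorph1 mulrDl barl mul1r -scalerAl e scalerA -vpowD.
by rewrite addNr vpow0 scale1r.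
Qed.

Hypothesis d1 : d = 1%N.

(** Every length is the length of a level, and all edges are of the form
    [t_s t_w = t_sw], so that [kappa = 1]. *)
Lemma hecke_lower_ideals : exists below : W -> seq W,
  [/\ forall w, setT w -> uniq (below w),
      forall w, setT w -> forall y, y \in below w <-> setT y /\ (len y < len w)%N
    & forall w, setT w -> weight bar (len w) (t w + \sum_(y <- below w) t y)].
Proof.
pose x c i := t (alt g c i); pose theta c y := (t (g c) + 1) * y.
have lt_alt c i : reduced g i.+1 -> (len (alt g (~~ c) i) < len (g c * alt g (~~ c) i)%g)%N.
  move=> ri; rewrite -[(_ * _)%g]/(alt g c i.+1) !(len_alt cox) //.
  exact: reduced_le ri.
have barD : {morph bar : y z / y + z} by apply: rmorphD.
have thetaD c : {morph theta c : y z / y + z} by move=> y z; rewrite /theta mulrDr.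
have thetaZ c a y : theta c (a *: y) = a *: theta c y by rewrite /theta scalerAr.
have bar_theta c y : bar (theta c y) = vpow (- (2 * d)%:Z) *: theta c (bar y).
  by rewrite /theta rmorphM bar_gen -scalerAl.
have weight1 : weight bar 0 (t 1%g).
  by rewrite /weight (hecke_one heckeH) rmorph1 vpow0 scale1r.
apply: (@lower_ideals _ _ cox setT id) => // [b k i _|c i ri|w i _].
- by split=> // ki; lia.
- have := @weight_ideal_sum _ bar barD bar_vpowZ d theta thetaD bar_theta thetaZ
    (t 1%g) x id i.+1 1; apply=> // [c' j ji|c' j ji|c'|c'|j|c'|c'].
  + by apply: mul_gen_up; apply: (lt_alt c' j.+1); apply: reduced_le ri.
  + by apply: mul_gen_down; apply: (lt_alt c' j.+1); apply: reduced_le ri.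
  + by rewrite scale1r; apply/mul_gen_up/len_gen.
  + by rewrite addrAC subrr add0r; apply/mul_gen_down/len_gen.
  + by rewrite d1 addn1.
  + rewrite /ideal_sum addrC -mul_gen_up; last exact: len_gen.
    by have := weight_theta bar_theta thetaZ c' weight1; rewrite d1.
  + by rewrite /= subrr scale0r /weight rmorph0 scaler0.
- by lia.
Qed.

End Hecke.

(** * The module of twisted involutions *)

Section Restriction.
Variables (H : algType laurent) (M : lmodType H).

(** An alias of M, to carry the scalar action [lscale] beside that of H. *)
Definition restricted : Type := M.
HB.instance Definition _ := GRing.Zmodule.on restricted.

Let lscaleA (c c' : laurent) (m : restricted) :
  lscale c (lscale c' m) = lscale (c * c') m :> M.
Proof. by rewrite /lscale scalerA -scalerAl mul1r scalerA. Qed.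

Let lscale1 : left_id 1 (@lscale H M).
Proof. by move=> m; rewrite /lscale !scale1r. Qed.

Let lscaleDr : right_distributive (@lscale H M) +%R.
Proof. by move=> c m m'; rewrite /lscale scalerDr. Qed.

Let lscaleDl (m : restricted) : {morph (@lscale H M)^~ m : c c' / c + c'}.
Proof. by move=> c c'; rewrite /lscale !scalerDl. Qed.

HB.instance Definition _ := GRing.Zmodule_isLmodule.Build laurent restricted
  lscaleA lscale1 lscaleDr lscaleDl.

End Restriction.

Section Twisted.
Variables (W : groupType) (g : bool -> W).
Hypotheses (cox : coxeter_system (range g)) (g_inj : injective g).
Notation len := (len (range g)).
Variable star : W -> W.
Hypothesis star_inv : diagram_involution (range g) star.
Notation D := (twisted_involutions star).

Lemma star_gen : exists eps, forall c, star (g c) = g (c (+) eps).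
Proof.
have starg c : exists b, star (g c) = g b.
  have : (star @` range g) (star (g c)) by exists (g c) => //; exists c.
  by rewrite (star_S star_inv) => -[b _ <-]; exists b.
have star_inj : injective star := can_inj (star_invol star_inv).
have [b b_eq] := starg false; have [b' b'_eq] := starg true.
have bb' : b != b'.
  by apply/eqP => e; have /star_inj/g_inj : star (g false) = star (g true)
    by rewrite b_eq b'_eq e.
by exists b => -[]; rewrite ?b_eq ?b'_eq //; case: b b' bb' {b_eq b'_eq} => [] [].
Qed.

Variable eps : bool.
Hypothesis starg : forall c, star (g c) = g (c (+) eps).

Lemma star1 : star 1%g = 1%g.
Proof. by apply: (mulgI (star 1%g)); rewrite -(star_morph star_inv) !mulg1. Qed.

Lemma starV w : (star w^-1 = (star w)^-1)%g.
Proof. by symmetry; apply: mulg1_eq; rewrite -(star_morph star_inv) mulgV star1. Qed.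

Lemma star_alt c k : star (alt g c k) = alt g (c (+) eps) k.
Proof.
elim: k c => [|k IHk] c; first exact: star1.
by rewrite /= (star_morph star_inv) starg IHk addNb.
Qed.

Lemma twisted_alt c k : odd k (+) eps -> D (alt g c k).
Proof.
by move=> kE; rewrite /twisted_involutions /= star_alt (altV cox);
  congr alt; case: c eps (odd k) kE => [] [] [].
Qed.

(** The involution shifts the first letter of an alternating word by [eps],
    inversion shifts it if the length is even. *)
Lemma twisted_altE c k : reduced g k.+1 -> D (alt g c k) <-> k = 0%N \/ odd k (+) eps.
Proof.
move=> rk; split=> [|[->|]]; last exact: twisted_alt; last first.
  by rewrite /twisted_involutions /= star1 invg1.
rewrite /twisted_involutions /= star_alt (altV cox).
have [->|k0] := posnP k; first by left.
right; have := alt_neq cox (b := c (+) eps) k0 rk.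
by case: c eps (odd k) H => [] [] [].
Qed.

Let ell i := (2 * i - ~~ eps)%N.

Lemma twisted_level c k i : reduced g k.+1 -> (ell i <= k < ell i.+1)%N ->
  D (alt g c k) <-> k = ell i.
Proof.
by move=> rk; rewrite /ell => ki; rewrite twisted_altE //; split; case: eps ki => /=; lia.
Qed.

Lemma twistK c w : twist star (g c) (twist star (g c) w) = w.
Proof.
have sK v : (v * star (g c) * star (g c) = v)%g.
  by rewrite -mulgA -(star_morph star_inv) gen_invol // star1 mulg1.
rewrite {2}/twist; case: eqP => e; rewrite /twist.
  by rewrite gen_mulK // e sK eqxx.
rewrite !mulgA gen_invol // mul1g sK; case: eqP => [e'|_]; last by rewrite sK.
by case: e; rewrite e'.
Qed.

Lemma twisted_twist c w : D w -> D (twist star (g c) w).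
Proof.
rewrite /twisted_involutions /twist /= => Dw.
case: eqP => e; rewrite !(star_morph star_inv) !invgM Dw -?starV (gen_inv cox).
  by move/(congr1 (fun x => x^-1)%g): e; rewrite !invgM -starV (gen_inv cox).
by rewrite (star_invol star_inv) mulgA.
Qed.

Variables (H : algType laurent) (T : W -> H) (barH : {rmorphism H -> H}).
Hypotheses (heckeH : hecke_algebra (range g) (q ^+ 2) T) (hbarH : hecke_bar T barH).
Variables (M : lmodType H) (a : W -> M) (bar : {additive M -> M}).
Hypotheses (moduleM : twisted_module (range g) star T a)
  (tbar : twisted_bar barH a bar).

Notation V := (restricted M).
Let aV : W -> V := a.
Let theta c (x : V) : V := (T (g c) + 1) *: (x : M).
Let u := vpow (2 * 2)%:Z.

Let uE : u = q ^+ 2.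
Proof. by rewrite q_exp. Qed.

Let Sg b : range g (g b). Proof. by exists b. Qed.

Let thetaE c (x : V) : theta c x = (T (g c) *: (x : M) : V) + x.
Proof. by rewrite /theta scalerDl scale1r. Qed.

(** Both ends of an edge [w < twist s w] are sent by [T s + 1] to multiples of
    their sum, as [twist s] exchanges them; the multiples depend on whether
    [s * w] and [w * star s] agree. *)
Lemma theta_commuting c w : D w -> (len w < len (g c * w)%g)%N ->
  (g c * w)%g = (w * star (g c))%g ->
  theta c (aV w) = (1 + q) *: (aV w + aV (g c * w)%g) /\
  theta c (aV (g c * w)%g) = (1 + u - (1 + q)) *: (aV w + aV (g c * w)%g).
Proof.
move=> Dw lt e; have tw : twist star (g c) w = (g c * w)%g by rewrite /twist e eqxx.
have lt' : bruhat_lt (range g) w (g c * w)%g by apply/bruhat_ltP.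
have := twisted_down1 moduleM (Sg c) (twisted_twist c Dw).
rewrite twistK tw gen_mulK // => /(_ erefl lt') down.
have := twisted_up1 moduleM (Sg c) Dw tw; rewrite tw => /(_ lt') up.
rewrite !thetaE; split.
  have -> : (T (g c) *: (aV w : M) : V) = (q + 1) *: aV (g c * w)%g + q *: aV w := up.
  by rewrite scalerDr -addrA -{2}[aV w]scale1r -scalerDl addrC [q + 1]addrC.
have -> : (T (g c) *: (aV (g c * w)%g : M) : V) =
    (q ^+ 2 - q) *: aV w + (q ^+ 2 - q - 1) *: aV (g c * w)%g := down.
rewrite -addrA -{2}[aV (g c * w)%g]scale1r -scalerDl subrK -scalerDr uE.
by congr (_ *: _); ring.
Qed.

Lemma theta_noncommuting c w : D w ->
  (len w < len (g c * w * star (g c))%g)%N ->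
  (g c * w)%g <> (w * star (g c))%g ->
  theta c (aV w) = aV w + aV (g c * w * star (g c))%g /\
  theta c (aV (g c * w * star (g c))%g) =
    u *: (aV w + aV (g c * w * star (g c))%g).
Proof.
move=> Dw lt /eqP/negbTE e; set w' := (_ * _)%g in lt *.
have tw : twist star (g c) w = w' by rewrite /twist e.
have lt' : bruhat_lt (range g) w w' by apply/bruhat_ltP.
have := twisted_down2 moduleM (Sg c) (twisted_twist c Dw).
rewrite twistK tw.
have -> : (g c * w' * star (g c) = w)%g.
  rewrite /w' !mulgA (gen_invol cox) mul1g -mulgA -(star_morph star_inv).
  by rewrite (gen_invol cox) star1 mulg1.
move=> /(_ erefl lt') down.
have := twisted_up2 moduleM (Sg c) Dw tw; rewrite tw => /(_ lt') up.
rewrite !thetaE; split.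
  by have -> : (T (g c) *: (aV w : M) : V) = aV w' := up; rewrite addrC.
have -> : (T (g c) *: (aV w' : M) : V) =
    (q ^+ 2) *: aV w + (q ^+ 2 - 1) *: aV w' := down.
by rewrite -addrA -{2}[aV w']scale1r -scalerDl subrK -scalerDr uE.
Qed.

(** For a twisted involution that starts with the other generator, [g c]
    lengthens it on both sides, unless the two sides reach the longest
    element together. *)
Lemma theta_alt c k : odd k (+) eps -> reduced g k.+2 ->
  theta c (aV (alt g (~~ c) k)) = aV (alt g (~~ c) k) + aV (alt g c k.+2) /\
  theta c (aV (alt g c k.+2)) = u *: (aV (alt g (~~ c) k) + aV (alt g c k.+2)).
Proof.
move=> kE rk.
have rk1 := reduced_le (leqnSn k.+1) rk; have rk0 := reduced_le (leqnSn k) rk1.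
have ce : c (+) eps = ~~ c (+) odd k by case: c eps (odd k) kE => [] [] [].
have w'E : alt g c k.+2 = (g c * alt g (~~ c) k * star (g c))%g.
  by rewrite starg ce -mulgA -altSr.
rewrite w'E; apply: theta_noncommuting; rewrite -?w'E; first exact: twisted_alt.
  by rewrite !(len_alt cox).
rewrite starg ce -altSr -[(_ * _)%g]/(alt g c k.+1).
exact: (alt_neq cox (b := c)).
Qed.

Lemma theta_alt_longest c k : odd k (+) eps -> reduced g k.+1 ->
  alt g true k.+1.*2 = 1%g ->
  theta c (aV (alt g (~~ c) k)) =
  (1 + q) *: (aV (alt g (~~ c) k) + aV (alt g c k.+1)).
Proof.
move=> kE rk tk; rewrite [alt g c _]/=.
have ce : c (+) eps = ~~ c (+) odd k by case: c eps (odd k) kE => [] [] [].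
have [] // := @theta_commuting c (alt g (~~ c) k) (twisted_alt _ kE).
  rewrite -[(_ * _)%g]/(alt g c k.+1) !(len_alt cox) //.
  exact: reduced_le rk.
by rewrite starg ce -altSr -(alt_swap cox _ tk) negbK.
Qed.

Let barV : V -> V := bar.

Let barD : {morph barV : x y / x + y}. Proof. exact: (raddfD bar). Qed.

Let barZ n (x : V) : barV (vpow n *: x) = vpow (- n) *: barV x.
Proof.
rewrite [LHS](twisted_barZ tbar (vpow n)%:A (x : M)).
by rewrite (hecke_bar_v hbarH).
Qed.

(** The levels have length [2 * i] if the involution swaps the generators, and
    [2 * i - 1] (truncated at i = 0) if it is the identity. In the latter case
    1 commutes with the generators, whence [kappa = 1 + q]. *)
Lemma twisted_lower_ideals : exists below : W -> seq W,
  [/\ forall w, D w -> uniq (below w),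
      forall w, D w -> forall y, y \in below w <-> D y /\ (len y < len w)%N
    & forall w, D w ->
        weight barV (len w) (aV w + \sum_(y <- below w) aV y)].
Proof.
have heckeH' : hecke_algebra (range g) u T by rewrite uE.
have thetaD c : {morph theta c : y z / y + z} by move=> y z; rewrite /theta scalerDr.
have thetaZ c k (y : V) : theta c (k *: y) = k *: theta c y.
  rewrite /theta; rewrite -[k *: y]/(lscale k (y : M)) -[RHS]/(lscale k _) /lscale.
  by rewrite !scalerA mulr_algl mulr_algr.
have bar_theta c (y : V) :
    barV (theta c y) = vpow (- (2 * 2)%:Z) *: theta c (barV y).
  rewrite [LHS](twisted_barZ tbar) (bar_gen cox g_inj heckeH' hbarH).
  by rewrite -[RHS]/(lscale _ _) /lscale scalerA mulr_algl.
have weight1 : weight barV 0 (aV 1%g).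
  by rewrite /weight vpow0 scale1r; apply: (twisted_bar1 tbar).
have scale_inj := scale_1q_inj (V := V) (twisted_basis moduleM).
have r2 := reduced2 cox g_inj.
have D1 : D 1%g by rewrite /twisted_involutions /= star1 invg1.
pose x c i := aV (alt g c (ell i)); pose kappa : laurent := if eps then 1 else 1 + q.
have ellSS i : ell i.+2 = (ell i.+1 + 2)%N by rewrite /ell; case: eps => /=; lia.
have odd_ell i : odd (ell i.+1) (+) eps by rewrite /ell; case: eps => /=; lia.
have base c : theta c (aV 1%g) = kappa *: (aV 1%g + x c 1%N) /\
    theta c (x c 1%N) = (1 + u - kappa) *: (aV 1%g + x c 1%N).
  rewrite /x /kappa /ell; case epsE: eps.
    have [] := @theta_alt c 0; rewrite ?epsE // => -> ->.
    by rewrite scale1r addrAC subrr add0r.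
  have gcE : (g c * 1 = alt g c 1)%g by [].
  have := @theta_commuting c 1%g D1; rewrite gcE; apply.
    by rewrite -gcE; apply: len_gen.
  by rewrite starg epsE addbF alt1 mul1g.
have up c i : reduced g (ell i.+2) ->
    theta c (x (~~ c) i.+1) = x (~~ c) i.+1 + x c i.+2 /\
    theta c (x c i.+2) = u *: (x (~~ c) i.+1 + x c i.+2).
  by rewrite /x ellSS addn2 => ri; apply: theta_alt.
have ell_le i j : (i <= j)%N -> (ell i <= ell j)%N by rewrite /ell; lia.
have weight_base c : weight barV (ell 1) (ideal_sum (aV 1%g) x c 0).
  have := weight_theta bar_theta thetaZ c weight1; have [-> _] := base c.
  rewrite /ideal_sum addrC /kappa /ell; case: eps; first by rewrite scale1r.
  exact: weight_div1q.
have weight_lower0 c : weight barV (ell 1 + 2)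
    (lower_term 2 (aV 1%g) x kappa c 0).
  have := weight_base c; rewrite /lower_term /kappa /ell; case: eps => /=.
    by move=> _; rewrite subrr scale0r /weight (bar0 barD) scaler0.
  by rewrite addrAC subrr add0r => w1; apply: (weight_vpow barZ 1).
have hyps i : reduced g (ell i.+1) -> forall c j, (j.+1 < i.+1)%N ->
    theta c (x (~~ c) j.+1) = x (~~ c) j.+1 + x c j.+2 /\
    theta c (x c j.+2) = u *: (x (~~ c) j.+1 + x c j.+2).
  by move=> ri c j ji; apply: up; apply: reduced_le ri; apply: ell_le.
apply: (@lower_ideals _ _ cox D ell) => // [i|c k i|c i ri|w i Dw wi].
- by rewrite /ell; case: eps => /=; lia.
- exact: twisted_level.
- refine (weight_ideal_sum (N := i.+1) barD barZ thetaD bar_theta thetaZ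
    _ _ _ _ ellSS weight_base weight_lower0 c (ltnSn i)) => [c' j ji|c' j ji|c'|c'].
  + by have [] := hyps i ri c' j ji.
  + by have [] := hyps i ri c' j ji.
  + by have [] := base c'.
  + by have [] := base c'.
- have [b wE] := altP cox w; have rw := reduced_len cox (w := w).
  have w_top : ~ reduced g (len w).+1.
    move=> rw'; have : len w = ell i.
      by apply/(twisted_level b rw'); rewrite -?wE //; lia.
    by move: wi; lia.
  have tw : alt g true (len w).*2 = 1%g.
    by have [||] := reducedS _ rw => //; move: wi; lia.
  case: i wi => [|i] wi.
    have w1 : len w = 1%N by move: wi; rewrite /ell; case: eps => /=; lia.
    by rewrite w1 in w_top.
  have wl : len w = (ell i.+1).+1 by move: wi; rewrite ellSS; lia.
  have ri : reduced g (ell i.+1) by apply: reduced_le rw; rewrite wl.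
  rewrite wl; refine (weight_top (N := i.+1) barD barZ scale_inj thetaD bar_theta
    thetaZ _ _ _ _ ellSS weight_base weight_lower0 (c := b) (ltnSn i) erefl _)
    => [c' j ji|c' j ji|c'|c'|].
  + by have [] := hyps i ri c' j ji.
  + by have [] := hyps i ri c' j ji.
  + by have [] := base c'.
  + by have [] := base c'.
  + by rewrite wE wl; apply: theta_alt_longest; rewrite -?wl.
Qed.

End Twisted.

(** * Positivity and monotonicity in rank two *)

Lemma card2_range (T : Type) (S : set T) : S #= `I_2 ->
  exists2 g : bool -> T, injective g & S = range g.
Proof.
move=> /card_set_bijP[f [fS f_inj f_surj]].
have [x Sx fx] := f_surj 0%N isT; have [y Sy fy] := f_surj 1%N isT.
exists (fun b : bool => if b then y else x).
  by move=> [] [] // e; move: fy; rewrite ?e ?fx // -e fx.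
apply/seteqP; split=> [s Ss|_ [[] _ <-] //].
have sE z : S z -> f z = f s -> z = s by move=> Sz; apply: f_inj; rewrite inE.
have := fS s Ss; case fs: (f s) => [|[|//]] _.
- by exists false => //; apply: sE; rewrite ?fx.
- by exists true => //; apply: sE; rewrite ?fy.
Qed.

Theorem corollary4p4
  (W : groupType) (S : set W) (star : W -> W)
  (Hq : algType laurent) (t : W -> Hq) (barq : {rmorphism Hq -> Hq})
  (P : W -> W -> {poly int})
  (Hq2 : algType laurent) (T : W -> Hq2) (barq2 : {rmorphism Hq2 -> Hq2})
  (M : lmodType Hq2) (a : W -> M) (barM : {additive M -> M})
  (Ps : W -> W -> {poly int}) :
  coxeter_system S -> S #= `I_2 -> diagram_involution S star ->
  hecke_algebra S q t -> hecke_bar t barq -> kl_polynomials S t barq P ->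
  hecke_algebra S (q ^+ 2) T -> hecke_bar T barq2 ->
  twisted_module S star T a -> twisted_bar barq2 a barM ->
  twisted_kl_polynomials S star a barM Ps ->
  property_A' star P Ps /\ property_B' S star P Ps.
Proof.
move=> cox /card2_range[g g_inj SE]; rewrite {}SE in cox *.
move=> star_inv heckeq hbarq klP heckeq2 hbarq2 modM tbar klPs.
have [eps starg] := star_gen g_inj star_inv.
pose D := twisted_involutions star; pose ln := len (range g).
have ltP y w := bruhat_ltP cox y w.
have Pww w : P w w = 1 by rewrite (kl_delta klP) ?eqxx // => -[].
have Psww w : D w -> Ps w w = 1.
  by move=> Dw; rewrite (twisted_kl_delta klPs) ?eqxx // => -[].
have P_lt y w : (ln y < ln w)%N -> P y w = 1.
  have heckeq' : hecke_algebra (range g) (vpow (2 * 1)%:Z) t by [].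
  have [below [bU bP bW]] := hecke_lower_ideals cox g_inj heckeq' hbarq erefl.
  move=> yw; apply: (kl_polynomials_trivial (rmorphD barq) (bar_vpowZ hbarq)
    (hecke_basis heckeq) bU bP bW (P := P^~ w) (w := w)) => //.
  - exact: (kl_bar klP).
  - move=> z _ zw lt; rewrite (kl_delta klP); last by move/ltP; apply/negP.
    by case: eqP zw.
  - by move=> z _ lt; apply: (kl_degree klP); apply/ltP.
have Ps_lt y w : D y -> D w -> (ln y < ln w)%N -> Ps y w = 1.
  have [below [bU bP bW]] :=
    twisted_lower_ideals cox g_inj star_inv starg heckeq2 hbarq2 modM tbar.
  move=> Dy Dw yw; apply: (kl_polynomials_trivial (V := restricted M) (bar := barM)
    _ _ (twisted_basis modM) bU bP bW (P := Ps^~ w) (w := w)) => //.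
  - exact: (raddfD barM).
  - move=> n x; rewrite [LHS](twisted_barZ tbar (vpow n)%:A (x : M)).
    by rewrite (hecke_bar_v hbarq2).
  - exact: (twisted_kl_bar klPs).
  - exact: Psww.
  - move=> z Dz zw lt; rewrite (twisted_kl_delta klPs) //; last by move/ltP; apply/negP.
    by case: eqP zw.
  - by move=> z Dz lt; apply: (twisted_kl_degree klPs) => //; apply/ltP.
have P_le y w : bruhat_le (range g) y w -> P y w = 1.
  by move/(bruhat_leP cox) => [->|/P_lt].
have Ps_le y w : D y -> D w -> bruhat_le (range g) y w -> Ps y w = 1.
  by move=> Dy Dw /(bruhat_leP cox)[->|]; [apply: Psww | apply: Ps_lt].
have P_nle y w : ~ bruhat_le (range g) y w -> P y w = 0.
  move=> nle; rewrite (kl_delta klP) => [|[//]].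
  by case: eqP => // e; case: nle; rewrite e; apply: bruhat_refl.
have Ps_nle y w : D y -> D w -> ~ bruhat_le (range g) y w -> Ps y w = 0.
  move=> Dy Dw nle; rewrite (twisted_kl_delta klPs) // => [|[//]].
  by case: eqP => // e; case: nle; rewrite e; apply: bruhat_refl.
have minus0 y w : D y -> D w -> P_minus P Ps y w = 0.
  move=> Dy Dw; rewrite /P_minus; have [le|nle] := EM (bruhat_le (range g) y w).
    by rewrite P_le // Ps_le // subrr scaler0.
  by rewrite P_nle // Ps_nle // subrr scaler0.
have plus1 y w : D y -> D w -> bruhat_le (range g) y w -> P_plus P Ps y w = 1.
  move=> Dy Dw le; rewrite /P_plus P_le // Ps_le // rmorph1.
  by rewrite -mulr2n -scaler_nat scalerA mulVf ?scale1r.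
have plus0 y w : D y -> D w -> ~ bruhat_le (range g) y w -> P_plus P Ps y w = 0.
  by move=> Dy Dw nle; rewrite /P_plus P_nle // Ps_nle // rmorph0 addr0 scaler0.
have nneg0 : nonneg_coefs 0 by move=> i; rewrite coef0.
have nneg1 : nonneg_coefs 1 by move=> i; rewrite coef1; case: (i == 0%N).
have plus_nneg y w : D y -> D w -> nonneg_coefs (P_plus P Ps y w).
  move=> Dy Dw; have [le|nle] := EM (bruhat_le (range g) y w).
    by rewrite plus1.
  by rewrite plus0.
split=> [y w Dy Dw|y z w Dy Dz Dw yz].
  by split; [apply: plus_nneg | rewrite minus0].
split; last by rewrite !minus0 // subr0.
have [zw|nzw] := EM (bruhat_le (range g) z w); last first.
  by rewrite [P_plus P Ps z w]plus0 // subr0; apply: plus_nneg.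
rewrite !plus1 ?subrr //; apply/(bruhat_leP cox).
move: yz zw => /(bruhat_leP cox)[->|yz] /(bruhat_leP cox)[zw|zw]; first by left.
- by right.
- by right; rewrite -zw.
- by right; apply: ltn_trans zw.
Qed.
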